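(* Let $T$ be a non-associative ring, let $T[Y]$ be the polynomial ring over $T$ in the indeterminate $Y$, and let $\delta : T[Y] \to T[Y]$ be a $T$-linear map with $\delta(1) = 0$. If $T$ is simple and for each positive $n \in \mathbb{N}$ there is a non-zero $k_n \in Z(T)$ such that $\delta(Y^n) = k_n Y^{n-1}$, then the non-associative Weyl algebra $T[Y][X; \mathrm{id}_{T[Y]}, \delta]$ is simple.
   Context: A non-associative ring is an additive abelian group with a (not necessarily associative) multiplication that is left and right distributive, and with a multiplicative identity $1$. Ideals are two-sided; a ring is simple if $\{0\}$ and the ring itself are its only ideals. The center $Z(T)$ is the set of elements $r\in T$ that commute with all elements of $T$ and satisfy $(r,s,t)=(s,r,t)=(s,t,r)=0$ for all $s,t\in T$, where $(r,s,t)=(rs)t-r(st)$. $T[Y]$ is the set of formal polynomials $\sum_i t_iY^i$, $t_i \in T$, with the usual addition and with multiplication the biadditive extension of $aY^m\cdot bY^n = (ab)Y^{m+n}$. For a non-associative ring $R$ and an additive map $\delta:R\to R$ with $\delta(1)=0$, $R[X;\mathrm{id}_R,\delta]$ is the set of formal polynomials $\sum_i r_i X^i$ ($r_i\in R$) with the usual addition and with multiplication the biadditive extension of $aX^m \cdot bX^n = \sum_{i=0}^m \binom{m}{i} a\,\delta^{m-i}(b) X^{i+n}$, for $a,b\in R$, $m,n\in\mathbb{N}$. When $R=T[Y]$ and $\delta$ is $T$-linear with $\delta(1)=0$, this ring is called a non-associative Weyl algebra. *)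

(* Defs.v *)
(* MathComp, with the finitely supported functions of multinomials. *)
From HB Require Import structures.
From mathcomp Require Import all_boot all_algebra.
From mathcomp Require Import finmap monalg.

Set Implicit Arguments.
Unset Strict Implicit.
Unset Printing Implicit Defensive.

Import GRing.Theory.

Declare Scope na_scope.
Delimit Scope na_scope with na.

Local Open Scope ring_scope.

(* Not required to be nontrivial: the zero ring is allowed. *)
HB.mixin Record Zmodule_isNonAssocRing R of GRing.Zmodule R := {
  namul : R -> R -> R;
  naone : R;
  namulDl : left_distributive namul +%R;
  namulDr : right_distributive namul +%R;
  namul1l : left_id naone namul;
  namul1r : right_id naone namul
}.

#[short(type="naRingType")]
HB.structure Definition NonAssocRing :=
  { R of GRing.Zmodule R & Zmodule_isNonAssocRing R }.

Notation "x ** y" := (namul x y) (at level 40, left associativity) : na_scope.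

Open Scope na_scope.

Section NonAssocRingTheory.
Variable R : naRingType.
Implicit Types (r s t x y : R) (I : R -> Prop).

Definition associator r s t := (r ** s) ** t - r ** (s ** t).

Definition na_center r : Prop :=
  (forall s, r ** s = s ** r) /\
  (forall s t, [/\ associator r s t = 0, associator s r t = 0
                 & associator s t r = 0]).

Record na_ideal I : Prop := NaIdeal {
  na_ideal0 : I 0;
  na_idealB : forall x y, I x -> I y -> I (x - y);
  na_idealMl : forall r x, I x -> I (r ** x);
  na_idealMr : forall r x, I x -> I (x ** r)
}.

Definition na_simple : Prop :=
  forall I, na_ideal I -> (forall x, I x <-> x = 0) \/ (forall x, I x).

Lemma namul0l x : 0 ** x = 0.
Proof. by apply: (addrI (0 ** x)); rewrite -namulDl !addr0. Qed.

Lemma namul0r x : x ** 0 = 0.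
Proof. by apply: (addrI (x ** 0)); rewrite -namulDr !addr0. Qed.

End NonAssocRingTheory.

Arguments na_simple R : clear implicits.

(* A formal polynomial over V is a finitely supported function nat -> V,
   << a *g n >> being the monomial with coefficient a and exponent n. *)
Section BiadditiveExtension.
Variables (V : zmodType) (W : zmodType) (phi : V -> nat -> V -> nat -> W).

Definition biadd_ext (p q : {malg V[nat]}) : W :=
  \sum_(m <- msupp p) \sum_(n <- msupp q) phi p@_m m q@_n n.

Hypothesis phiDl : forall a a' m b n,
  phi (a + a') m b n = phi a m b n + phi a' m b n.
Hypothesis phiDr : forall a m b b' n,
  phi a m (b + b') n = phi a m b n + phi a m b' n.

Let phi0l m b n : phi 0 m b n = 0.
Proof. by apply: (addrI (phi 0 m b n)); rewrite -phiDl !addr0. Qed.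

Let phi0r a m n : phi a m 0 n = 0.
Proof. by apply: (addrI (phi a m 0 n)); rewrite -phiDr !addr0. Qed.

Let sum_widen (d d' : {fset nat}) (F : nat -> W) :
    (d `<=` d')%fset -> (forall n, n \notin d -> F n = 0) ->
  \sum_(n <- d) F n = \sum_(n <- d') F n.
Proof. by move=> dd' F0; apply: big_fset_incl => // n _; apply: F0. Qed.

Lemma biadd_extEw (p q : {malg V[nat]}) (d e : {fset nat}) :
    (msupp p `<=` d)%fset -> (msupp q `<=` e)%fset ->
  biadd_ext p q = \sum_(m <- d) \sum_(n <- e) phi p@_m m q@_n n.
Proof.
move=> pd qe; rewrite /biadd_ext (sum_widen pd); last first.
  move=> m mp; apply: big1 => n _; by rewrite (mcoeff_outdom mp).
apply: eq_bigr => m _; apply: sum_widen => // n nq.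
by rewrite (mcoeff_outdom nq).
Qed.

Lemma biadd_extDl p p' q : biadd_ext (p + p') q = biadd_ext p q + biadd_ext p' q.
Proof.
have pd := fsubsetUl (msupp p) (msupp p').
have pd' := fsubsetUr (msupp p) (msupp p').
rewrite (biadd_extEw (msuppD_le p p') (fsubset_refl (msupp q))).
rewrite (biadd_extEw pd (fsubset_refl _)) (biadd_extEw pd' (fsubset_refl _)).
rewrite -big_split; apply: eq_bigr => m _; rewrite -big_split.
by apply: eq_bigr => n _; rewrite mcoeffD phiDl.
Qed.

Lemma biadd_extDr p q q' : biadd_ext p (q + q') = biadd_ext p q + biadd_ext p q'.
Proof.
have qd := fsubsetUl (msupp q) (msupp q').
have qd' := fsubsetUr (msupp q) (msupp q').
rewrite (biadd_extEw (fsubset_refl (msupp p)) (msuppD_le q q')).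
rewrite (biadd_extEw (fsubset_refl _) qd) (biadd_extEw (fsubset_refl _) qd').
rewrite -big_split; apply: eq_bigr => m _; rewrite -big_split.
by apply: eq_bigr => n _; rewrite mcoeffD phiDr.
Qed.

Lemma biadd_extU a m b n : biadd_ext << a *g m >> << b *g n >> = phi a m b n.
Proof.
by rewrite (biadd_extEw msuppU_le msuppU_le) !big_seq_fset1 !mcoeffUU.
Qed.

Lemma biadd_extUl a m q :
  biadd_ext << a *g m >> q = \sum_(n <- msupp q) phi a m q@_n n.
Proof.
by rewrite (biadd_extEw msuppU_le (fsubset_refl _)) big_seq_fset1 mcoeffUU.
Qed.

Lemma biadd_extUr p b n :
  biadd_ext p << b *g n >> = \sum_(m <- msupp p) phi p@_m m b n.
Proof.
rewrite (biadd_extEw (fsubset_refl _) msuppU_le); apply: eq_bigr => m _.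
by rewrite big_seq_fset1 mcoeffUU.
Qed.

End BiadditiveExtension.

Definition napoly (T : naRingType) : Type := {malg T[nat]}.

HB.instance Definition _ (T : naRingType) := 
  GRing.Zmodule.copy (napoly T) {malg T[nat]}.

Section Polynomials.
Variable T : naRingType.
Implicit Types (a b t : T) (p q : napoly T).

Definition monomial (a : T) (n : nat) : napoly T := << a *g n >>.

Definition napoly_mul_monom a m b n : napoly T := monomial (a ** b) (m + n).

Definition napoly_mul : napoly T -> napoly T -> napoly T :=
  biadd_ext napoly_mul_monom.

Let monomDl a a' m b n : napoly_mul_monom (a + a') m b n
  = napoly_mul_monom a m b n + napoly_mul_monom a' m b n.
Proof. by rewrite /napoly_mul_monom namulDl; apply: monalgUD. Qed.

Let monomDr a m b b' n : napoly_mul_monom a m (b + b') n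
  = napoly_mul_monom a m b n + napoly_mul_monom a m b' n.
Proof. by rewrite /napoly_mul_monom namulDr; apply: monalgUD. Qed.

Fact napoly_mulDl : left_distributive napoly_mul +%R.
Proof. by move=> p p' q; apply: biadd_extDl. Qed.

Fact napoly_mulDr : right_distributive napoly_mul +%R.
Proof. by move=> p q q'; apply: biadd_extDr. Qed.

Fact napoly_mul1l : left_id (monomial naone 0) napoly_mul.
Proof.
move=> p; rewrite /napoly_mul biadd_extUl // [RHS](monalgE (p : {malg T[nat]})).
by apply: eq_bigr => n _; rewrite /napoly_mul_monom namul1l.
Qed.

Fact napoly_mul1r : right_id (monomial naone 0) napoly_mul.
Proof.
move=> p; rewrite /napoly_mul biadd_extUr // [RHS](monalgE (p : {malg T[nat]})).
by apply: eq_bigr => n _; rewrite /napoly_mul_monom namul1r addn0.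
Qed.

HB.instance Definition _ := Zmodule_isNonAssocRing.Build (napoly T)
  napoly_mulDl napoly_mulDr napoly_mul1l napoly_mul1r.

Lemma napoly_mulU a m b n :
  monomial a m ** monomial b n = monomial (a ** b) (m + n).
Proof. exact: biadd_extU. Qed.

(* T acts on T[Y] by left multiplication by constants; additivity is not part
   of this predicate but of the bundled type of delta below. *)
Definition T_linear (f : napoly T -> napoly T) : Prop :=
  forall t p, f (monomial t 0 ** p) = monomial t 0 ** f p.

End Polynomials.

(* R[X; id_R, delta]; the type depends on the proof of delta(1) = 0, without
   which the monomial 1 X^0 is not a right identity. *)
Definition ore_ext (R : naRingType) (delta : {additive R -> R})
  of delta naone = 0 : Type := {malg R[nat]}.

HB.instance Definition _ (R : naRingType) (delta : {additive R -> R})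
  (delta1 : delta naone = 0) := 
  GRing.Zmodule.copy (ore_ext delta1) {malg R[nat]}.

Section OreExtension.
Variables (R : naRingType) (delta : {additive R -> R}).
Hypothesis delta1 : delta naone = 0.
Implicit Types (a b : R).
Local Notation S := (ore_ext delta1).

Definition ore_monomial (a : R) (n : nat) : S := << a *g n >>.

Definition ore_mul_monom a m b n : S :=
  \sum_(i < m.+1) ore_monomial ((a ** iter (m - i) delta b) *+ 'C(m, i)) (i + n).

Definition ore_mul : S -> S -> S := biadd_ext ore_mul_monom.

Let iter0 k : iter k delta 0 = 0.
Proof. by elim: k => //= k ->; rewrite raddf0. Qed.

Let iterD k b b' : iter k delta (b + b') = iter k delta b + iter k delta b'.
Proof. by elim: k => //= k ->; rewrite raddfD. Qed.

Let iter1 k : (0 < k)%N -> iter k delta naone = 0.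
Proof. by case: k => // k _; rewrite iterSr delta1. Qed.

Let monomDl a a' m b n : ore_mul_monom (a + a') m b n
  = ore_mul_monom a m b n + ore_mul_monom a' m b n.
Proof.
rewrite /ore_mul_monom -big_split; apply: eq_bigr => i _.
by rewrite namulDl mulrnDl; apply: monalgUD.
Qed.

Let monomDr a m b b' n : ore_mul_monom a m (b + b') n
  = ore_mul_monom a m b n + ore_mul_monom a m b' n.
Proof.
rewrite /ore_mul_monom -big_split; apply: eq_bigr => i _.
by rewrite iterD namulDr mulrnDl; apply: monalgUD.
Qed.

Fact ore_mulDl : left_distributive ore_mul +%R.
Proof. by move=> p p' q; apply: biadd_extDl. Qed.

Fact ore_mulDr : right_distributive ore_mul +%R.
Proof. by move=> p q q'; apply: biadd_extDr. Qed.

Fact ore_mul1l : left_id (ore_monomial naone 0) ore_mul.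
Proof.
move=> p; rewrite /ore_mul biadd_extUl // [RHS](monalgE (p : {malg R[nat]})).
apply: eq_bigr => n _; rewrite /ore_mul_monom big_ord1 /= namul1l.
by rewrite mulr1n.
Qed.

Fact ore_mul1r : right_id (ore_monomial naone 0) ore_mul.
Proof.
move=> p; rewrite /ore_mul biadd_extUr // [RHS](monalgE (p : {malg R[nat]})).
apply: eq_bigr => m _; rewrite /ore_mul_monom big_ord_recr /= subnn /= namul1r.
rewrite binn mulr1n addn0 big1 ?add0r // => i _.
by rewrite iter1 ?subn_gt0 // namul0r mul0rn; apply: monalgU0.
Qed.

HB.instance Definition _ := Zmodule_isNonAssocRing.Build S
  ore_mulDl ore_mulDr ore_mul1l ore_mul1r.

Lemma ore_mulU a m b n :
  ore_monomial a m ** ore_monomial b n =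
  \sum_(i < m.+1)
     ore_monomial ((a ** iter (m - i) delta b) *+ 'C(m, i)) (i + n).
Proof. exact: biadd_extU. Qed.

End OreExtension.

Definition weyl_algebra (T : naRingType)
    (delta : {additive napoly T -> napoly T})
    (delta_lin : T_linear delta) (delta1 : delta naone = 0) : naRingType :=
  ore_ext delta1.

(* Main.v *)
Require Import Defs.
From mathcomp Require Import all_boot all_algebra.
From mathcomp Require Import finmap monalg.
Local Open Scope ring_scope.

Set Implicit Arguments.
Unset Strict Implicit.
Unset Printing Implicit Defensive.

Import GRing.Theory.

(** Let [I] be a non-zero ideal of the Weyl algebra. Two commutators shrink its
elements without killing them.

Taking [X p - p X] applies [delta] to every coefficient of [p] in [T[Y]]
([ore_commX]). Since [delta] sends [t Y^(n+1)] to [(t k) Y^n] with a non-zero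
central [k], and right multiplication by such a [k] is injective because [T] is
simple ([central_mulr_eq0]), this lowers positive degrees in [Y] by exactly one. After
finitely many steps one reaches a non-zero element [q] of [I] whose
coefficients lie in [T], of no larger degree in [X] ([ideal_const_coefs]).

If [q] has degree [m > 0] in [X], take [q Y^m - Y^m q]. The terms in [X^m]
cancel, as [Y^m] commutes with [T[Y]]. The coefficient of [X^0] is the sum over
[j > 0] of [q_j delta^j(Y^m)], in which only [j = m] contributes in degree [0]
in [Y]; so the commutator is a non-zero element of [I] of smaller degree in [X]
([ideal_lower_degree]). The exponent [m], rather than [1], makes the argument
independent of the characteristic: the coefficient of [X^0] involves only the
binomial coefficients ['C(j, 0) = 1], while commuting with [Y] itself would
produce the factor [m].

By induction on the degree in [X], [I] contains a non-zero element of [T]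
([ideal_meets_const]). Then [I] meets [T] in a non-zero ideal of [T], hence
contains [1]. *)

(** * Ideals and central elements of non-associative rings *)

Section NonAssocRings.
Variable R : naRingType.
Implicit Types (x y : R) (I : R -> Prop).

Lemma namul_suml J (r : seq J) (F : J -> R) y :
  (\sum_(i <- r) F i) ** y = \sum_(i <- r) F i ** y.
Proof.
exact: (big_morph (fun x => x ** y) (fun x x' => namulDl x x' y) (namul0l y)).
Qed.

Lemma na_ideal_full I : na_ideal I -> I naone -> forall x, I x.
Proof. by move=> idI I1 x; rewrite -[x]namul1r; apply: na_idealMl. Qed.

(** The annihilator [{x | x k = 0}] is a two-sided ideal, because [k] commutes
and associates with everything; it misses [1] as soon as [k] is non-zero. *)
Lemma central_mulr_eq0 k x :
  na_simple R -> k <> 0 -> na_center k -> x ** k = 0 -> x = 0.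
Proof.
move=> simR kN0 [kC kA] xk0.
have assocr r s : (r ** s) ** k = r ** (s ** k).
  by apply/eqP; rewrite -subr_eq0; apply/eqP; case: (kA r s).
have idJ : na_ideal (fun x => x ** k = 0).
  split=> [|y z yk0 zk0|r y yk0|r y yk0]; first exact: namul0l.
  - apply: (addIr (z ** k)); rewrite -namulDl subrK yk0 zk0.
    by rewrite addr0.
  - by rewrite assocr yk0 namul0r.
  - have assocm : (y ** k) ** r = y ** (k ** r).
      by apply/eqP; rewrite -subr_eq0; apply/eqP; case: (kA y r).
    by rewrite assocr -kC -assocm yk0 namul0l.
case: (simR _ idJ) => [J0|JT]; first exact/J0.
by case: kN0; rewrite -[k]namul1l; apply: JT.
Qed.

End NonAssocRings.

(** * Formal polynomials *)

Section FinitelySupported.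
Variables (V W : zmodType).
Implicit Type p : {malg V[nat]}.

(** Most identities below are additive in the polynomial, so that they
need be checked on monomials only. *)
Lemma malg_additive_ext (f g : {malg V[nat]} -> W) :
    {morph f : p q / p + q} -> {morph g : p q / p + q} ->
    (forall a n, f << a *g n >> = g << a *g n >>) ->
  f =1 g.
Proof.
move=> fD gD fgU p; rewrite (monalgE p).
apply: (big_ind (fun q => f q = g q)) => [|q q' fgq fgq'|n _]; last exact: fgU.
- by rewrite -(@monalgU0 _ V 0%N) fgU.
- by rewrite fD gD fgq fgq'.
Qed.

Lemma malg_bounded p : exists d, forall n, (d <= n)%N -> p@_n = 0.
Proof.
exists (\max_(n <- msupp p) n).+1 => n; rewrite ltnNge => /negP len.
apply: mcoeff_outdom; apply/negP => np; apply: len.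
by rewrite (big_fsetD1 n) //= leq_maxl.
Qed.

End FinitelySupported.

Section NonAssocPolynomials.
Variable T : naRingType.
Implicit Types (t : T) (p f : napoly T).

Lemma napoly_constMl t p n : (monomial t 0 ** p)@_n = t ** p@_n.
Proof.
apply: (malg_additive_ext (f := fun p : napoly T => (monomial t 0 ** p)@_n)
   (g := fun p : napoly T => t ** p@_n)) => [q q'|q q'|a m].
- by rewrite namulDr mcoeffD.
- by rewrite mcoeffD namulDr.
- rewrite (napoly_mulU t 0 a m) /monomial !mcoeffU add0n.
  by case: eqP => _; rewrite ?namul0r.
Qed.

(** Exponents add commutatively and [1] is a two-sided unit, so [T] itself need
not be commutative here. *)
Lemma napoly_YnC n p : monomial naone n ** p = p ** monomial naone n.
Proof.
apply: (malg_additive_ext (f := fun p : napoly T => monomial naone n ** p)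
   (g := fun p : napoly T => p ** monomial naone n)) => [q q'|q q'|a m].
- exact: namulDr.
- exact: namulDl.
- rewrite (napoly_mulU naone n a m) (napoly_mulU a m naone n).
  by rewrite namul1l namul1r addnC.
Qed.

End NonAssocPolynomials.

(** * Coefficients of products in an Ore extension *)

Section OreCoefficients.
Variables (R : naRingType) (delta : {additive R -> R}).
Hypothesis delta1 : delta naone = 0.
Local Notation S := (ore_ext delta1).
Implicit Types (b : R) (p : S).

(** The condition [i <= j] on the terms that reach [X^i] is carried by the
binomial coefficient, which vanishes when the subtraction [j - i] truncates. *)
Lemma ore_coefMr p b i :
  (p ** ore_monomial delta1 b 0)@_i
  = \sum_(j <- msupp p) (p@_j ** iter (j - i) delta b) *+ 'C(j, i).
Proof.
rewrite {1}(monalgE (p : {malg R[nat]})).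
rewrite (namul_suml (R := S)) raddf_sum; apply: eq_bigr => j _.
rewrite (ore_mulU delta1 (p@_j) j b 0) raddf_sum /=.
have [leij|ltji] := leqP i j; last first.
  rewrite bin_small // mulr0n big1 // => l _.
  rewrite /ore_monomial mcoeffU addn0.
  by case: eqP => // eli; have := ltn_ord l; rewrite eli ltnS leqNgt ltji.
rewrite (bigD1 (inord i : 'I_j.+1)) //= big1 ?addr0 => [|l /eqP nli].
  by rewrite /ore_monomial inordK ?ltnS // addn0 mcoeffUU.
rewrite /ore_monomial mcoeffU addn0; case: eqP => // eli; case: nli.
by apply: val_inj; rewrite /= inordK.
Qed.

(** From the degree of [p] upwards, [b] is not differentiated. *)
Lemma ore_coefMr_top p b i :
  (forall j, (i < j)%N -> p@_j = 0) ->
  (p ** ore_monomial delta1 b 0)@_i = p@_i ** b.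
Proof.
move=> ptop; rewrite ore_coefMr.
have term0 j : j != i -> (p@_j ** iter (j - i) delta b) *+ 'C(j, i) = 0.
  rewrite neq_ltn => /orP[ltji|ltij]; first by rewrite bin_small // mulr0n.
  by rewrite ptop // namul0l mul0rn.
have [ip|iNp] := boolP (i \in msupp p).
  rewrite (big_fsetD1 i) //= subnn binn mulr1n big1_fset ?addr0 // => j.
  by rewrite in_fsetD1 => /andP[ji _] _; apply: term0.
rewrite (mcoeff_outdom iNp) namul0l big1_fset // => j jp _.
by apply: term0; apply: contraNneq iNp => <-.
Qed.

Lemma ore_coefMl b p i : (ore_monomial delta1 b 0 ** p)@_i = b ** p@_i.
Proof.
apply: (malg_additive_ext (f := fun p : S => (ore_monomial delta1 b 0 ** p)@_i)
   (g := fun p : S => b ** p@_i)) => [q q'|q q'|a m].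
- by rewrite namulDr mcoeffD.
- by rewrite mcoeffD namulDr.
- rewrite (ore_mulU delta1 b 0 a m) big_ord1 /= mulr1n add0n /ore_monomial.
  by rewrite !mcoeffU; case: eqP => _; rewrite ?namul0r.
Qed.

(** This is [X r = r X + delta r], together with [r X^m X = r X^(m+1)], which
holds because [delta] kills [1]. *)
Lemma ore_commX p i :
  (ore_monomial delta1 naone 1 ** p - p ** ore_monomial delta1 naone 1)@_i
  = delta p@_i.
Proof.
apply: (malg_additive_ext (f := fun p : S =>
     (ore_monomial delta1 naone 1 ** p - p ** ore_monomial delta1 naone 1)@_i)
   (g := fun p : S => delta p@_i)) => [q q'|q q'|a m].
- by rewrite namulDr namulDl opprD addrACA mcoeffD.
- by rewrite mcoeffD raddfD.
have -> : ore_monomial delta1 a m ** ore_monomial delta1 naone 1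
    = ore_monomial delta1 a m.+1.
  rewrite (ore_mulU delta1 a m naone 1) big_ord_recr /= subnn /= namul1r.
  rewrite binn mulr1n addn1 big1 ?add0r // => l _.
  rewrite -[(m - l)%N]prednK ?subn_gt0 // iterSr delta1.
  have -> : iter (m - l).-1 delta 0 = 0 by elim: (_.-1) => //= k ->; rewrite raddf0.
  by rewrite namul0r mul0rn; apply: monalgU0.
rewrite (ore_mulU delta1 naone 1 a m) !big_ord_recr big_ord0 /= add0r.
rewrite bin0 binn !mulr1n !namul1l add0n add1n addrK /ore_monomial !mcoeffU.
by case: eqP; rewrite ?raddf0.
Qed.

End OreCoefficients.

(** * Ideals of the Weyl algebra *)

Section WeylAlgebra.
Variables (T : naRingType) (delta : {additive napoly T -> napoly T}).
Hypotheses (delta_lin : T_linear delta) (delta1 : delta naone = 0).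
Hypothesis simT : na_simple T.
Variable k : nat -> T.
Hypotheses (kN0 : forall n, k n <> 0) (kZ : forall n, na_center (k n)).
Hypothesis deltaY : forall n, delta (monomial naone n.+1) = monomial (k n) n.
Local Notation S := (ore_ext delta1).
Implicit Types (t : T) (f : napoly T) (p q : S) (I : S -> Prop).

(** [deltaY] and [T]-linearity give this on monomials [a Y^m]; the case [m = 0]
is [delta 1 = 0]. *)
Lemma delta_coef f n : (delta f)@_n = f@_n.+1 ** k n.
Proof.
apply: (malg_additive_ext (f := fun f : napoly T => (delta f)@_n)
   (g := fun f : napoly T => f@_n.+1 ** k n)) => [q q'|q q'|a m].
- by rewrite raddfD mcoeffD.
- by rewrite mcoeffD namulDl.
have -> : << a *g m >> = monomial a 0 ** monomial naone m.
  by rewrite napoly_mulU namul1r.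
rewrite delta_lin !napoly_constMl; case: m => [|m].
  rewrite delta1 mcoeff0 /monomial mcoeffU /= mulr0n.
  by rewrite !namul0r namul0l.
rewrite deltaY /monomial !mcoeffU eqSS.
by case: eqP => [->|_]; rewrite ?mulr1n ?namul1r // !namul0r namul0l.
Qed.

(** [delta] lowers positive degrees in [Y] by exactly one: the products of the [k n] that
appear when it is iterated never annihilate a coefficient. *)
Lemma delta_iter_coef_eq0 j f n : (iter j delta f)@_n = 0 <-> f@_(n + j)%N = 0.
Proof.
elim: j n => [|j IHj] n; first by rewrite addn0.
rewrite iterS delta_coef addnS -addSn -IHj.
by split=> [/(central_mulr_eq0 simT (@kN0 n) (kZ n))|->] //; rewrite namul0l.
Qed.

Lemma delta_iter_const_lin j t f :
  monomial t 0 ** iter j delta f = iter j delta (monomial t 0 ** f).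
Proof. by elim: j => //= j <-; rewrite delta_lin. Qed.

Definition const_coefs p := forall j n, p@_j@_n.+1 = 0.

Lemma const_coefsE p j : const_coefs p -> p@_j = monomial p@_j@_0 0.
Proof.
move=> cp; apply/malgP => -[|n]; first by rewrite /monomial mcoeffUU.
by rewrite cp /monomial mcoeffU.
Qed.

Lemma coefs_bounded p : exists d, forall j n, (d <= n)%N -> p@_j@_n = 0.
Proof.
have bnd j := malg_bounded (p@_j : {malg T[nat]}).
have [N pN] := malg_bounded (p : {malg (napoly T)[nat]}).
suff [d pd] : exists d, forall j n, (j < N)%N -> (d <= n)%N -> p@_j@_n = 0.
  exists d => j n dn; have [Nj|jN] := leqP N j; last exact: pd.
  by rewrite pN // mcoeff0.
elim: N {pN} => [|N [d pd]]; first by exists 0%N.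
have [e pe] := bnd N; exists (maxn d e) => j n.
rewrite ltnS leq_eqVlt geq_max => /orP[/eqP->|jN] /andP[dn en].
  exact: pe.
exact: pd.
Qed.

(** Commute with [X] until just before the element would vanish: an element
killed by this commutator already has its coefficients in [T]. The bound on
the degree in [Y] makes the process stop. *)
Lemma ideal_const_coefs I p m : na_ideal I -> I p -> p <> 0 ->
    (forall j, (m <= j)%N -> p@_j = 0) ->
  exists q, [/\ I q, q <> 0, const_coefs q
              & forall j, (m <= j)%N -> q@_j = 0].
Proof.
move=> idI; have [d] := coefs_bounded p.
elim: d p => [|d IHd] p pd Ip pN0 pm.
  by exists p; split=> // j n; rewrite pd.
pose X := ore_monomial delta1 naone 1.
pose q : S := X ** p - p ** X.
have qE j n : q@_j@_n = p@_j@_n.+1 ** k n by rewrite ore_commX delta_coef.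
have [q0|/eqP qN0] := eqVneq q 0.
  exists p; split=> // j n; apply: (central_mulr_eq0 simT (@kN0 n) (kZ n)).
  by rewrite -qE q0 !mcoeff0.
apply: (IHd q) => // [j n dn||j mj].
- by rewrite qE pd // namul0l.
- by apply: na_idealB => //; [apply: na_idealMl|apply: na_idealMr].
- by rewrite ore_commX pm // raddf0.
Qed.

(** The element is the commutator of [q] with [Y^(m+1)]. Its top term cancels
because powers of [Y] commute with coefficients, and the term of [q] in
[X^(m+1)] leaves a non-zero constant, [Y^(m+1)] being differentiated exactly
as many times as its degree. *)
Lemma ideal_lower_degree I q m : na_ideal I -> I q -> const_coefs q ->
    (forall j, (m.+1 < j)%N -> q@_j = 0) -> q@_m.+1 <> 0 ->
  exists p, [/\ I p, p <> 0 & forall j, (m.+1 <= j)%N -> p@_j = 0].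
Proof.
move=> idI Iq cq qm qmN0.
pose b : napoly T := monomial naone m.+1.
pose Y : S := ore_monomial delta1 b 0.
(* Y^(m+1) is moved to the right of the coefficient, so that the two terms
   compare directly. *)
have commE i : (q ** Y - Y ** q)@_i = (q ** Y)@_i - q@_i ** b.
  rewrite mcoeffB [X in _ - X](ore_coefMl b q i).
  by congr (_ - _); apply: napoly_YnC.
exists (q ** Y - Y ** q : S); split.
- by apply: na_idealB => //; [apply: na_idealMr|apply: na_idealMl].
(* The commutator is non-zero: look at its coefficient in X^0 Y^0. *)
- have coef00 : (q@_0 ** b)@_0 = 0.
    by rewrite (const_coefsE 0 cq) napoly_constMl /monomial mcoeffU namul0r.
  move=> qY0; have : (q ** Y - Y ** q)@_0@_0 = 0 by rewrite qY0 !mcoeff0.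
  rewrite commE mcoeffB coef00 subr0 ore_coefMr.
  have mq : m.+1 \in msupp q by rewrite -mcoeff_neq0; apply/eqP.
  rewrite (big_fsetD1 m.+1) //= mcoeffD.
  (* By T-linearity, the j-th summand is delta^j (t Y^(m+1)) with t constant, so
     its coefficient in Y^0 is non-zero only for j = m+1. *)
  have cE j : ((q@_j ** iter (j - 0) delta b) *+ 'C(j, 0))@_0
      = (iter j delta (monomial q@_j@_0 m.+1))@_0.
    rewrite bin0 mulr1n subn0 {1}(const_coefsE j cq) delta_iter_const_lin.
    by rewrite napoly_mulU namul1r.
  rewrite [X in _ + X]raddf_sum [X in _ + X]big1_fset ?addr0 => [|j]; last first.
    rewrite in_fsetD1 => /andP[/negPf jm _] _; rewrite /= cE.
    by apply/delta_iter_coef_eq0; rewrite /monomial mcoeffU eq_sym jm.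
  rewrite cE => /delta_iter_coef_eq0; rewrite /monomial mcoeffUU => qm0.
  by apply: qmN0; rewrite (const_coefsE _ cq) qm0; apply: monalgU0.
(* From degree m+1 on, both products have the same coefficients q_i Y^(m+1). *)
- move=> i mi; rewrite commE ore_coefMr_top ?subrr //.
  by move=> j ij; apply: qm; apply: leq_ltn_trans ij.
Qed.

Lemma ideal_meets_const I p m : na_ideal I -> I p -> p <> 0 ->
    (forall j, (m <= j)%N -> p@_j = 0) ->
  exists2 t, t <> 0 & I (ore_monomial delta1 (monomial t 0) 0).
Proof.
move=> idI; elim: m p => [|m IHm] p Ip pN0 pm.
  by case: pN0; apply/malgP => j; rewrite pm // mcoeff0.
have [q [Iq qN0 cq qm]] := ideal_const_coefs idI Ip pN0 pm.
have [qm0|/eqP qmN0] := eqVneq q@_m 0.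
  apply: (IHm q) => // j; rewrite leq_eqVlt => /orP[/eqP<- //|]; exact: qm.
case: m IHm {pm} qm qmN0 => [|m] IHm qm qmN0.
  (* Degree 0 in X: q is itself a constant of T. *)
  exists q@_0@_0 => [q00|].
    by apply: qmN0; rewrite (const_coefsE _ cq) q00; apply: monalgU0.
  rewrite -(const_coefsE _ cq); suff <- : q = ore_monomial delta1 q@_0 0 by [].
  apply/malgP => -[|j]; first by rewrite /ore_monomial mcoeffUU.
  by rewrite qm // /ore_monomial mcoeffU.
have [p' [Ip' p'N0 p'm]] := ideal_lower_degree idI Iq cq qm qmN0.
exact: IHm p'm.
Qed.

Lemma weyl_simple : na_simple S.
Proof.
move=> I idI.
(* By simplicity of T, the ideal of the t with emb t in I is 0 or T. *)
pose emb t : S := ore_monomial delta1 (monomial t 0) 0.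
have embB t u : emb (t - u) = emb t - emb u.
  by rewrite /emb /monomial monalgUB; apply: monalgUB.
have embM t u : emb (t ** u) = emb t ** emb u.
  by rewrite /emb ore_mulU big_ord1 /= mulr1n napoly_mulU.
have idJ : na_ideal (fun t => I (emb t)).
  split=> [|t u It Iu|t u Iu|t u Iu].
  - by rewrite -(subrr 0) embB subrr; apply: na_ideal0.
  - by rewrite embB; apply: na_idealB.
  - by rewrite embM; apply: na_idealMl.
  - by rewrite embM; apply: na_idealMr.
case: (simT idJ) => [J0|JT]; last by right; apply: na_ideal_full idI (JT _).
left=> p; split=> [Ip|->]; last exact: na_ideal0.
have [//|/eqP pN0] := eqVneq p 0.
have [m pm] := malg_bounded (p : {malg (napoly T)[nat]}).
have [t tN0 /J0 t0] := ideal_meets_const idI Ip pN0 pm.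
by case: (tN0 t0).
Qed.

End WeylAlgebra.

Theorem theorem32 (T : naRingType)
    (delta : {additive napoly T -> napoly T})
    (delta_lin : T_linear delta) (delta1 : delta naone = 0) :
  na_simple T ->
  (forall n : nat, (0 < n)%N ->
     exists k : T, [/\ k <> 0, na_center k &
       delta (monomial naone n) = monomial k n.-1]) ->
  na_simple (weyl_algebra delta_lin delta1).
Proof.
(* Reading k_(n+1) off as a coefficient gives a sequence without choice. *)
move=> simT deltaY; pose k n := (delta (monomial naone n.+1))@_n.
have kP n : [/\ k n <> 0, na_center (k n)
               & delta (monomial naone n.+1) = monomial (k n) n].
  have [c [cN0 cZ dY]] := deltaY n.+1 isT.
  by rewrite /k dY /= /monomial mcoeffUU.
by apply: (@weyl_simple T delta delta_lin delta1 simT k) => n; case: (kP n).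
Qed.
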